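(* Let $N\ge1$ be an integer and $\lambda_1,\lambda_2\in\mathbb{C}$ with $\lambda_1,\lambda_2\notin\{0,-1,\dots,-(N-1)\}$ and $\lambda_1+\lambda_2\notin\{0,-1,\dots,-(2N-2)\}$. For $l=0,1,\dots,N$ define the polynomials in $x,y$ \[v_l=x^ly^{N-l},\qquad w_l=(x+y)^NP^{\lambda_1,\lambda_2}_l\Bigl(\frac{y-x}{x+y}\Bigr).\] Then, for $l=0,1,\dots,N$, \[w_l=\frac{(\lambda_1)_l}{l!}\sum_{k=0}^N\binom{N}{k}Q_{l,k}\,v_k,\] \[v_l=\sum_{k=0}^N\binom{N}{k}\frac{k!\,(\lambda_1)_l(\lambda_2)_{N-l}}{(\lambda_2)_k(\lambda_1+\lambda_2+k-1)_k(\lambda_1+\lambda_2+2k)_{N-k}}\,Q_{k,l}\,w_k,\] where \[Q_{k,l}={}_3F_2\left(\begin{array}{c}-k,\ k+\lambda_1+\lambda_2-1,\ -l\\ \lambda_1,\ -N\end{array};1\right).\]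
   Context: Pochhammer symbols: $(x)_m=\prod_{i=0}^{m-1}(x+i)$. Hypergeometric series: ${}_3F_2\left(\begin{array}{c}a_1,a_2,a_3\\ b_1,b_2\end{array};x\right)=\sum_{n\ge0}\frac{(a_1)_n(a_2)_n(a_3)_n}{(b_1)_n(b_2)_n}\frac{x^n}{n!}$; in $Q_{k,l}$ with $0\le k,l\le N$ the sum runs over $0\le n\le\min(k,l)$. Jacobi polynomials (shifted parametrisation): for $\lambda,\lambda'\in\mathbb{C}$, $l\ge 0$, \[P^{\lambda,\lambda'}_l(x)=\frac{(\lambda)_l}{l!}\,{}_2F_1\left(\begin{array}{c}-l,\ l+\lambda+\lambda'-1\\ \lambda\end{array};\frac{1-x}{2}\right)=\frac1{2^l}\sum_{s=0}^l(-1)^s\binom{l+\lambda-1}{l-s}\binom{l+\lambda'-1}{s}(1-x)^s(1+x)^{l-s}\] (the usual parameters are $\alpha=\lambda-1$, $\beta=\lambda'-1$; the binomial coefficients are generalised, $\binom{a}{j}=\frac{a(a-1)\cdots(a-j+1)}{j!}$). *)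

(* Defs.v *)
From mathcomp Require Import all_boot all_order all_algebra.
From mathcomp Require Import reals complex fraction.
From mathcomp.multinomials Require Import mpoly.

Set Implicit Arguments.
Unset Strict Implicit.
Unset Printing Implicit Defensive.

Import GRing.Theory.
Local Open Scope ring_scope.

Definition poch (F : fieldType) (x : F) (m : nat) : F :=
  \prod_(i < m) (x + i%:R).

(* The partial sum over 0 <= n <= m of the hypergeometric series with upper
   parameters a and lower parameters b, as a polynomial in its argument.  All
   the series needed here terminate: a parameter -k with k : nat kills the terms
   n > k.  The cutoff m is explicit because a lower parameter -N would make
   terms with n > N read 0/0. *)
Definition hyper (F : fieldType) (m : nat) (a b : seq F) : {poly F} :=
  \poly_(n < m.+1)
    ((\prod_(c <- a) poch c n) / (\prod_(c <- b) poch c n) / n`!%:R).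

(* Shifted parameters: the usual ones are lam - 1 and lam' - 1.  The formula is
   meaningful when lam, ..., lam + l - 1 are nonzero. *)
Definition jacobi (F : fieldType) (lam lam' : F) (l : nat) : {poly F} :=
  (poch lam l / l`!%:R) *:
    (hyper l [:: - l%:R; l%:R + lam + lam' - 1] [:: lam]
       \Po (2%:R^-1 *: (1 - 'X))).

Definition Q (F : fieldType) (lam1 lam2 : F) (N k l : nat) : F :=
  (hyper (minn k l)
     [:: - k%:R; k%:R + lam1 + lam2 - 1; - l%:R] [:: lam1; - N%:R]).[1].

(* F(x, y); w below is written with a quotient, and it is a polynomial only after
   the denominators (x + y)^j cancel, so the identities live here.  The embedding
   of F[x, y] in F(x, y) is injective. *)
Definition ratfun (F : fieldType) := {fraction {mpoly F[2]}}.

Definition cst (F : fieldType) (c : F) : ratfun F := tofrac (c%:MP : {mpoly F[2]}).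
Definition varx (F : fieldType) : ratfun F := tofrac ('X_(inord 0) : {mpoly F[2]}).
Definition vary (F : fieldType) : ratfun F := tofrac ('X_(inord 1) : {mpoly F[2]}).

Definition v (F : fieldType) (N l : nat) : ratfun F :=
  varx F ^+ l * vary F ^+ (N - l).

Definition w (F : fieldType) (lam1 lam2 : F) (N l : nat) : ratfun F :=
  (varx F + vary F) ^+ N
  * (map_poly (@cst F) (jacobi lam1 lam2 l)).[(vary F - varx F) / (varx F + vary F)].

(* Main.v *)
(* Write a, b for lambda_1, lambda_2 and t = x / (x + y).  Dividing by (x + y)^N
   turns v_l into t^l (1 - t)^(N - l) and w_l into the polynomial jac l in t.
   The first identity comes from expanding each t^n = t^n (t + (1 - t))^(N - n)
   by the binomial theorem.  For the second, let
   D = t (1 - t) d^2/dt^2 + (a - (a + b) t) d/dt and theta k = k (k + a + b - 1).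
   Then D (jac k) = - theta k * jac k, while D sends t^l (1 - t)^(N - l) to a
   combination of its neighbours of index l - 1, l, l + 1.  The difference
   equation satisfied by l |-> Q_{k,l} gives the right-hand side the same
   three-term relation, so the identity follows by descending induction from
   l = N.  For l = N, Chu-Vandermonde evaluates Q_{k,N}, and the resulting
   expansion of t^N holds because both sides f have leading term t^N and satisfy
   D f + theta N * f = N (N - 1 + a) t^(N - 1), by induction on N, and D + theta N
   is injective in degrees below N. *)
Require Import Defs.
From HB Require Import structures.
From mathcomp Require Import all_boot all_order all_algebra.
From mathcomp Require Import reals complex fraction ring zify.
From mathcomp.multinomials Require Import mpoly.

Set Implicit Arguments.
Unset Strict Implicit.
Unset Printing Implicit Defensive.

Import GRing.Theory Num.Theory.
Local Open Scope ring_scope.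

(** * Pochhammer symbols and the Chu-Vandermonde sum *)

Section Pochhammer.
Variable F : numFieldType.
Implicit Types (x a b c : F) (k l n N : nat).

Lemma poch0 x : poch x 0 = 1.
Proof. by rewrite /poch big_ord0. Qed.

Lemma pochS x n : poch x n.+1 = poch x n * (x + n%:R).
Proof. by rewrite /poch big_ord_recr. Qed.

Lemma poch_recl x n : poch x n.+1 = x * poch (x + 1) n.
Proof.
rewrite /poch big_ord_recl /= addr0; congr (_ * _).
by apply: eq_bigr => i _; rewrite /bump /= natrD addrA.
Qed.

Lemma pochD x m n : poch x (m + n) = poch x m * poch (x + m%:R) n.
Proof.
rewrite /poch big_split_ord /=; congr (_ * _).
by apply: eq_bigr => i _; rewrite natrD addrA.
Qed.

Lemma poch_neq0 x n :
  (forall j, (j < n)%N -> x + j%:R != 0) -> poch x n != 0.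
Proof. by move=> x_neq0; apply/prodf_neq0 => i _; apply: x_neq0. Qed.

Lemma pochN_eq0 k n : (k < n)%N -> poch (- k%:R : F) n = 0.
Proof.
by move=> kn; apply/eqP/prodf_eq0; exists (Ordinal kn); rewrite //= addNr.
Qed.

Lemma pochN_neq0 k n : (n <= k)%N -> poch (- k%:R : F) n != 0.
Proof.
move=> nk; apply: poch_neq0 => j jn.
by rewrite addrC subr_eq0 eqr_nat neq_ltn (leq_trans jn nk).
Qed.

Lemma pochN k n : poch (- k%:R : F) n = (-1) ^+ n * (k ^_ n)%:R.
Proof.
elim: n => [|n IHn]; first by rewrite poch0 ffactn0 mulr1.
rewrite pochS IHn ffactnSr exprS; case: (leqP n k) => [nk|kn].
  by rewrite natrM natrB //; ring.
by rewrite ffact_small // mul0n !mulr0 mul0r.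
Qed.

(** Once the signs (-1)^n are removed, multiplying either side by (k - n)! (N - k)! gives N!. *)
Lemma bin_pochN N k n : (n <= k <= N)%N ->
  'C(N - n, k - n)%:R * poch (- N%:R : F) n = 'C(N, k)%:R * poch (- k%:R) n.
Proof.
move=> /andP[nk kN]; have nN := leq_trans nk kN.
rewrite !pochN mulrCA [RHS]mulrCA -!natrM; congr (_ * _%:R).
apply/eqP; rewrite -(eqn_pmul2r (fact_gt0 (k - n))) -(eqn_pmul2r (fact_gt0 (N - k))).
have eNk : (N - n - (k - n) = N - k)%N by rewrite subnBA // subnK.
apply/eqP; transitivity N`!.
  rewrite -(ffact_fact nN) -(bin_fact (leq_sub2r n kN)) eNk.
  by rewrite (mulnC _ (N ^_ n)) !mulnA.
by rewrite -(bin_fact kN) -(ffact_fact nk) !mulnA.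
Qed.

(** The value (c - b)_k / (c)_k of 2F1(-k, b; c; 1), multiplied through by (c)_k so that no
    denominator remains. *)
Lemma chu_vandermonde k b c :
  \sum_(n < k.+1) (-1) ^+ n * 'C(k, n)%:R * poch b n * poch (c + n%:R) (k - n)
  = poch (c - b) k.
Proof.
elim: k b c => [|k IHk] b c.
  by rewrite big_ord_recl big_ord0 /= !poch0 !mulr1 addr0.
rewrite pochS [RHS]mulrC.
(* The last factor is split so that the induction hypothesis serves twice, at (b, c) and at (b + 1,
   c + 1); Pascal's rule splits the sum in the same way. *)
have -> : c - b + k%:R = (c + k%:R) - b by ring.
rewrite mulrBl -{1}(IHk b c) -[in X in _ - _ * X](_ : c + 1 - (b + 1) = c - b); last by ring.
rewrite -(IHk (b + 1) (c + 1)) !mulr_sumr.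
rewrite big_ord_recl /= [X in _ = X - _]big_ord_recl /=.
rewrite (eq_bigr (fun i : 'I_k.+1 =>
  (-1) ^+ i.+1 * 'C(k, i.+1)%:R * poch b i.+1 * poch (c + i.+1%:R) (k - i)
  - b * ((-1) ^+ i * 'C(k, i)%:R * poch (b + 1) i * poch (c + 1 + i%:R) (k - i)))); last first.
  move=> i _; rewrite /bump /= add1n binS subSS natrD poch_recl exprS.
  rewrite -(addn1 i) natrD (addrC i%:R) addrA; ring.
rewrite big_split /= sumrN addrA; congr (_ + _ - _).
  by rewrite !bin0 subn0 !poch0 subn0 pochS addr0; ring.
rewrite big_ord_recr /= bin_small // mulr0 !mul0r addr0.
apply: eq_bigr => i _; rewrite /bump /= add1n.
rewrite -(subnSK (ltn_ord i)) (pochS _ (k - _)).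
have -> : c + k%:R = c + i.+1%:R + (k - i.+1)%:R :> F.
  by rewrite -addrA -natrD subnKC // ltn_ord.
ring.
Qed.

End Pochhammer.

(** * The hypergeometric differential operator and its polynomial eigenvectors *)

Section JacobiOperator.
Variables (F : numFieldType) (a b : F).
Implicit Types (f : {poly F}) (k l m n M N : nat).

Definition jac k : {poly F} :=
  (poch a k / k`!%:R) *: hyper k [:: - k%:R; k%:R + a + b - 1] [:: a].

Definition theta k : F := k%:R * (k%:R + a + b - 1).

Definition jac_op f : {poly F} :=
  'X * f^`()^`() - 'X * ('X * f^`()^`()) + a *: f^`() - (a + b) *: ('X * f^`()).

Lemma jac_op_is_linear : linear jac_op.
Proof.
move=> c f g; rewrite /jac_op !(derivD, derivZ) -!mul_polyC.
ring.
Qed.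

HB.instance Definition _ :=
  GRing.isLinear.Build F {poly F} {poly F} *:%R jac_op jac_op_is_linear.

Lemma coef_jac_op f n :
  (jac_op f)`_n = n.+1%:R * (n%:R + a) * f`_n.+1 - theta n * f`_n.
Proof.
rewrite /jac_op /theta !(coefB, coefD, coefZ, coefXM, coef_deriv).
by case: n => [|[|n]] /=; rewrite ?coef_deriv; ring.
Qed.

(** With exponent [l.+1] the lower neighbour always exists; at m = 0 the truncated [m.-1] is
    harmless because its coefficient vanishes. *)
Lemma jac_op_bernstein l m :
  jac_op ('X^(l.+1) * (1 - 'X) ^+ m) =
    (l.+1%:R * (l%:R + a)) *: ('X^l * (1 - 'X) ^+ m.+1)
    - (l.+1%:R * (b + m%:R) + m%:R * (a + l.+1%:R))
        *: ('X^(l.+1) * (1 - 'X) ^+ m)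
    + (m%:R * (m%:R - 1 + b)) *: ('X^(l.+2) * (1 - 'X) ^+ m.-1).
Proof.
have dX n : ('X^(n.+1))^`() = 'X^n *+ n.+1 :> {poly F} by rewrite derivXn.
have dY n : ((1 - 'X) ^+ n.+1)^`() = - ((1 - 'X) ^+ n *+ n.+1) :> {poly F}.
  by rewrite deriv_exp derivB derivX derivC sub0r mulN1r mulNrn.
have dX0 : ('X^0)^`() = 0 :> {poly F} by rewrite derivC.
have dY0 : ((1 - 'X) ^+ 0)^`() = 0 :> {poly F} by rewrite derivC.
rewrite /jac_op -!mul_polyC.
case: l => [|l]; case: m => [|[|m]];
  rewrite !(dX0, dY0, dX, dY, derivN, derivMn, derivD, derivC, derivM)
    -?pred_Sn ?(exprS, expr0); ring.
Qed.

(** The operator is triangular on monomials: if f had degree d < M, comparing coefficients of t^d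
    would force theta d = theta M. *)
Lemma jac_op_eigen_eq0 M f : (size f <= M)%N ->
  (forall n, (n < M)%N -> theta n != theta M) ->
  jac_op f = - theta M *: f -> f = 0.
Proof.
move=> sf thetaM eig; apply/eqP; apply: contraT => f0.
have sf0 : (0 < size f)%N by rewrite lt0n size_poly_eq0.
have lead : (jac_op f)`_(size f).-1 = - theta M * f`_(size f).-1.
  by rewrite eig coefZ.
move: lead; rewrite coef_jac_op prednK // (nth_default 0 (leqnn _)) mulr0 sub0r.
rewrite -mulNr => /mulIf-/(_ _)/oppr_inj e.
have := thetaM (size f).-1; rewrite prednK // e ?eqxx; first by move/(_ sf).
by rewrite -lead_coefE lead_coef_eq0.
Qed.

Definition jac_coef k n : F :=
  poch (- k%:R) n * poch (k%:R + a + b - 1) n / poch a n / n`!%:R.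

Lemma hyper_coef k n :
  (hyper k [:: - k%:R; k%:R + a + b - 1] [:: a])`_n = jac_coef k n.
Proof.
rewrite /hyper coef_poly !big_cons !big_nil !mulr1 /jac_coef ltnS.
by case: leqP => // /(pochN_eq0 F)->; rewrite !mul0r.
Qed.

(** The ratio of consecutive terms of the 2F1, with denominators cleared. Both sides vanish for n >=
    k, where the series has stopped. *)
Lemma jac_coef_rec k n : (forall j, (j < k)%N -> a + j%:R != 0) ->
  n.+1%:R * (n%:R + a) * jac_coef k n.+1
  = (n%:R - k%:R) * (n%:R + k%:R + a + b - 1) * jac_coef k n.
Proof.
move=> a_neq0; rewrite /jac_coef; case: (ltngtP n k) => [nk|kn|->].
- have an := a_neq0 n nk.
  have pn : poch a n != 0.
    by apply: poch_neq0 => j jn; apply: a_neq0; apply: ltn_trans jn nk.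
  have fn : n`!%:R != 0 :> F by rewrite pnatr_eq0 -lt0n fact_gt0.
  have n1 : 1 + n%:R != 0 :> F by rewrite addrC natr1 pnatr_eq0.
  by rewrite !pochS factS natrM; field; rewrite fn pn n1 an.
- by rewrite !pochN_eq0 ?(ltnW kn) ?ltnS ?(ltnW kn) //; ring.
- by rewrite pochN_eq0 // subrr; ring.
Qed.

(** Coefficientwise this is [jac_coef_rec], since (n - k)(n + k + a + b - 1) = theta n - theta k. *)
Lemma jac_op_jac k : (forall j, (j < k)%N -> a + j%:R != 0) ->
  jac_op (jac k) = - theta k *: jac k.
Proof.
move=> a_neq0; apply/polyP => n.
rewrite /jac linearZ coefZ coef_jac_op scalerA [_ * (_ / _)]mulrC -scalerA !coefZ.
rewrite !hyper_coef jac_coef_rec // /theta; ring.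
Qed.

Lemma jac_lead k : (forall j, (j < k)%N -> a + j%:R != 0) ->
  (jac k)`_k = (-1) ^+ k * poch (a + b + k%:R - 1) k / k`!%:R.
Proof.
move=> a_neq0; rewrite /jac coefZ hyper_coef /jac_coef pochN ffactnn.
have pk := poch_neq0 a_neq0.
have fk : k`!%:R != 0 :> F by rewrite pnatr_eq0 -lt0n fact_gt0.
have -> : k%:R + a + b - 1 = a + b + k%:R - 1 by ring.
by field; rewrite fk pk.
Qed.

Lemma size_jac k : (size (jac k) <= k.+1)%N.
Proof.
apply: leq_trans (size_scale_leq _ _) _; exact: size_poly.
Qed.

Lemma theta_diff k M : theta M - theta k = (M%:R - k%:R) * (a + b + (M + k)%:R - 1).
Proof. by rewrite /theta natrD; ring. Qed.

End JacobiOperator.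

(** * Expansion of monomials in Jacobi polynomials *)

Section Expansions.
Variables (F : numFieldType) (a b : F).
Implicit Types (f : {poly F}) (k l m n M N : nat).

Local Notation jac := (jac a b).
Local Notation theta := (theta a b).
Local Notation jac_op := (jac_op a b).
Local Notation jac_coef := (jac_coef a b).

(** The factors are a + b + i with k - 1 <= i <= 2k - 2, and 2k - 2 <= 2N - 2. *)
Lemma poch_shift_neq0 N k : (forall j, (j.+1 < 2 * N)%N -> a + b + j%:R != 0) ->
  (k <= N)%N -> poch (a + b + k%:R - 1) k != 0.
Proof.
move=> hab kN; apply: poch_neq0 => j jk.
have -> : a + b + k%:R - 1 + j%:R = a + b + (k.-1 + j)%:R.
  by rewrite -[in LHS](ltn_predK jk) natrD -natr1; ring.
by apply: hab; lia.
Qed.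

Lemma poch_double_shift_neq0 N k : (forall j, (j.+1 < 2 * N)%N -> a + b + j%:R != 0) ->
  poch (a + b + (2 * k)%:R) (N - k) != 0.
Proof.
move=> hab; apply: poch_neq0 => j jk.
by rewrite -addrA -natrD; apply: hab; lia.
Qed.

(** What the second identity predicts for l = N = M once Q_{k,N} is evaluated; the factor (b)_k has
    cancelled. *)
Definition mono_coef M k : F :=
  'C(M, k)%:R * (k`!%:R * poch a M * (-1) ^+ k
    / (poch a k * poch (a + b + k%:R - 1) k * poch (a + b + (2 * k)%:R) (M - k))).

(** This compares the coefficients of [jac k] in (D + theta (M+1)) t^(M+1) = (M+1)(M+a) t^M. *)
Lemma mono_coefS M k : (forall j, (j.+1 < 2 * M.+1)%N -> a + b + j%:R != 0) ->
  (k <= M)%N ->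
  mono_coef M.+1 k * (theta M.+1 - theta k)
  = M.+1%:R * (M%:R + a) * mono_coef M k.
Proof.
move=> hab kM; rewrite theta_diff /mono_coef.
rewrite (subSn kM) !pochS.
have -> : a + b + (2 * k)%:R + (M - k)%:R = a + b + (M + k)%:R.
  by rewrite -addrA -natrD; congr (_ + _%:R); lia.
have -> : a + b + (M.+1 + k)%:R - 1 = a + b + (M + k)%:R.
  by rewrite addSn -natr1; ring.
have s0 : a + b + (M + k)%:R != 0 by apply: hab; lia.
have : 'C(M.+1, k)%:R * (M.+1%:R - k%:R) = M.+1%:R * 'C(M, k)%:R :> F.
  by rewrite -natrB ?(leqW kM) // -!natrM mul_bin_down mulnC.
move: (a + b + (M + k)%:R) s0 => s s0 binE.
rewrite [poch a k * _ * (_ * s)]mulrA.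
move: (_ * poch (a + b + (2 * k)%:R) _) => D.
(* The factor s = a + b + M + k of the eigenvalue difference cancels the last factor of (a + b +
   2k)_{M+1-k}. *)
transitivity ('C(M.+1, k)%:R * (M.+1%:R - k%:R)
  * (k`!%:R * (poch a M * (a + M%:R)) * (-1) ^+ k / D) * (s / s)).
  by rewrite invfM; ring.
by rewrite divff // binE; ring.
Qed.

Lemma jac0 : jac 0 = 1.
Proof.
rewrite /jac poch0 fact0 divff ?oner_eq0 // scale1r; apply/polyP => n.
rewrite hyper_coef coef1 /jac_coef.
by case: n => [|n]; [rewrite !poch0 fact0 !divr1 mulr1 | rewrite pochN_eq0 // !mul0r].
Qed.

Lemma theta_inj_lt N n M : (forall j, (j.+1 < 2 * N)%N -> a + b + j%:R != 0) ->
  (n < M <= N)%N -> theta n != theta M.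
Proof.
move=> hab /andP[nM MN]; rewrite eq_sym -subr_eq0 theta_diff mulf_neq0 //.
  by rewrite subr_eq0 eqr_nat; lia.
have -> : a + b + (M + n)%:R - 1 = a + b + (M + n).-1%:R.
  have Mn : (0 < M + n)%N by lia.
  by rewrite -[in LHS](prednK Mn) -natr1; ring.
by apply: hab; lia.
Qed.

Lemma jac_op_monomial M :
  jac_op 'X^(M.+1) = (M.+1%:R * (M%:R + a)) *: 'X^M - theta M.+1 *: 'X^(M.+1).
Proof.
have := jac_op_bernstein a b M 0; rewrite expr0 mulr1 => ->.
by rewrite /theta -!mul_polyC !exprS expr0; ring.
Qed.

Lemma monomial_jac M :
  (forall j, (j < M)%N -> a + j%:R != 0) ->
  (forall j, (j.+1 < 2 * M)%N -> a + b + j%:R != 0) ->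
  'X^M = \sum_(k < M.+1) mono_coef M k *: jac k.
Proof.
elim: M => [|M IHM] ha hab.
  rewrite big_ord_recl big_ord0 addr0 jac0 /mono_coef !poch0 bin0 fact0.
  by rewrite expr0 !mulr1 divr1 mulr1 scale1r.
have {}IHM : 'X^M = \sum_(k < M.+1) mono_coef M k *: jac k.
  by apply: IHM => j jM; [apply: ha | apply: hab]; lia.
have jac_eig k : (k <= M.+1)%N -> jac_op (jac k) = - theta k *: jac k.
  by move=> kM; apply: jac_op_jac => j jk; apply: ha; lia.
have op_sum : jac_op (\sum_(k < M.+2) mono_coef M.+1 k *: jac k)
    + theta M.+1 *: (\sum_(k < M.+2) mono_coef M.+1 k *: jac k)
    = (M.+1%:R * (M%:R + a)) *: 'X^M.
  rewrite linear_sum IHM !scaler_sumr -big_split /= big_ord_recr /=.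
  have term k : (k <= M.+1)%N ->
      jac_op (mono_coef M.+1 k *: jac k) + theta M.+1 *: (mono_coef M.+1 k *: jac k)
      = (mono_coef M.+1 k * (theta M.+1 - theta k)) *: jac k.
    move=> kM; rewrite linearZ /= jac_eig // !scalerA -scalerDl.
    by congr (_ *: _); ring.
  (* The top term k = M + 1 is killed by D + theta (M+1), leaving the expansion of t^M. *)
  rewrite [X in _ + X]term // subrr mulr0 scale0r addr0.
  apply: eq_bigr => k _; have kM : (k <= M)%N by rewrite -ltnS.
  by rewrite term ?mono_coefS ?scalerA // ltnW.
apply/eqP; rewrite -subr_eq0; apply/eqP.
apply: (@jac_op_eigen_eq0 _ a b M.+1).
(* The difference has degree at most M: [mono_coef M.+1 M.+1] is the inverse of the leading
   coefficient of [jac M.+1], so the terms in t^(M+1) cancel. *)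
- apply/leq_sizeP => i Mi; rewrite coefB coefXn coef_sum big_ord_recr /=.
  rewrite big1 ?add0r => [|k _]; last first.
    have kM := ltn_ord k.
    by rewrite coefZ (nth_default _ (leq_trans (size_jac _ _ _) _)) ?mulr0 //; lia.
  rewrite coefZ; case: (ltngtP i M.+1) Mi => // [Mi _|-> _].
    by rewrite (nth_default _ (leq_trans (size_jac _ _ _) _)) ?mulr0 ?subrr.
  rewrite jac_lead // /mono_coef subnn poch0 binn.
  have pa := poch_neq0 ha; have pab := poch_shift_neq0 hab (leqnn _).
  have fM : (M.+1)`!%:R != 0 :> F by rewrite pnatr_eq0 -lt0n fact_gt0.
  transitivity (1 - ((-1) ^+ M.+1 * (-1) ^+ M.+1) : F); last first.
    by rewrite -expr2 sqrr_sign subrr.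
  by congr (_ - _); field; rewrite fM pab pa.
- by move=> n nM; apply: (theta_inj_lt hab); rewrite nM leqnn.
rewrite linearB /= jac_op_monomial -op_sum scalerBr !scaleNr opprK.
ring.
Qed.

(** * The difference equation in l for Q, and its value at l = N *)

Definition Q_coef N k n : F := jac_coef k n / poch (- N%:R) n.

(** The cutoff min(k, l) can be raised to k because (-l)_n = 0 for n > l. The range and [Q_coef] are
    then free of l, so difference operators in l act on (-l)_n alone. *)
Lemma Q_sum N k l :
  Q a b N k l = \sum_(n < k.+1) Q_coef N k n * poch (- l%:R) n.
Proof.
rewrite /Q /hyper horner_poly.
rewrite (big_ord_widen k.+1 (fun n => (\prod_(c <- [:: - k%:R; k%:R + a + b - 1; - l%:R]) poch c n
  / (\prod_(c <- [:: a; - N%:R]) poch c n) / n`!%:R) * 1 ^+ n)) ?ltnS ?geq_minl //.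
rewrite big_mkcond; apply: eq_bigr => n _.
rewrite !big_cons !big_nil expr1n !mulr1 /Q_coef /jac_coef invfM ltnS leq_min -ltnS ltn_ord /=.
by case: leqP => [_|/(pochN_eq0 F)->]; ring.
Qed.

Lemma Q_coef_rec N k n : (forall j, (j < N)%N -> a + j%:R != 0) ->
  (n <= k <= N)%N ->
  n.+1%:R * (N%:R - n%:R) * (a + n%:R) * Q_coef N k n.+1
  = - ((n%:R - k%:R) * (n%:R + k%:R + a + b - 1)) * Q_coef N k n.
Proof.
move=> ha /andP[nk kN]; rewrite /Q_coef pochS.
have rec : n.+1%:R * (n%:R + a) * jac_coef k n.+1
  = (n%:R - k%:R) * (n%:R + k%:R + a + b - 1) * jac_coef k n.
  by apply: jac_coef_rec => j jk; apply: ha; lia.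
have [nN|Nn] := ltnP n N; last first.
  (* Here n = k = N: the denominator (-N)_{N+1} is zero, but so is the numerator [jac_coef k k.+1],
     and the right-hand side contains n - k = 0. *)
  have -> : n = k by lia.
  by rewrite /jac_coef (pochN_eq0 _ (ltnSn k)); ring.
have Nn0 : - N%:R + n%:R != 0 :> F.
  by rewrite addrC subr_eq0 eqr_nat neq_ltn nN.
have pN : poch (- N%:R : F) n != 0 by apply: pochN_neq0; lia.
transitivity (- (n.+1%:R * (n%:R + a) * jac_coef k n.+1) / poch (- N%:R) n).
  by field; rewrite pN Nn0.
by rewrite rec; ring.
Qed.

(** The functions l |-> (-l)_n play the role of monomials: the difference operator sends each to a
    combination of itself and its predecessor. All terms reduce to multiples of (-(l+1))_n. *)
Lemma pochN_difference N m l n : (l.+1 + m = N)%N ->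
  l.+1%:R * (b + m%:R) * (poch (- l%:R) n.+1 - poch (- l.+1%:R) n.+1)
  + m%:R * (a + l.+1%:R) * (poch (- l.+2%:R) n.+1 - poch (- l.+1%:R) n.+1)
  = - (n.+1%:R * (a + b + n%:R) * poch (- l.+1%:R) n.+1)
    - n.+1%:R * (N%:R - n%:R) * (a + n%:R) * poch (- l.+1%:R) n.
Proof.
move=> <-.
have P1 : poch (- l.+1%:R : F) n.+1 = poch (- l.+1%:R) n * (- l.+1%:R + n%:R).
  exact: pochS.
have P2 : l.+1%:R * poch (- l%:R : F) n.+1
    = - (poch (- l.+1%:R) n * (- l.+1%:R + n%:R) * (- l%:R + n%:R)).
  have e : - l.+1%:R + 1 = - l%:R :> F by rewrite -natr1; ring.
  by rewrite pochS -P1 poch_recl e; ring.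
have P3 : poch (- l.+2%:R : F) n.+1 = - l.+2%:R * poch (- l.+1%:R) n.
  by rewrite poch_recl; congr (_ * poch _ _); rewrite -[l.+2%:R]natr1; ring.
rewrite mulrAC mulrBr P2 P1 P3 natrD; ring.
Qed.

(** The coefficients are those of [jac_op_bernstein] after rescaling the l-th Bernstein term by
    (a)_l (b)_{N-l}. At m = 0 the out-of-range index l + 2 = N + 1 has coefficient 0. *)
Lemma Q_difference N m k l : (forall j, (j < N)%N -> a + j%:R != 0) ->
  (k <= N)%N -> (l.+1 + m = N)%N ->
  l.+1%:R * (b + m%:R) * (Q a b N k l - Q a b N k l.+1)
  + m%:R * (a + l.+1%:R) * (Q a b N k l.+2 - Q a b N k l.+1)
  = - theta k * Q a b N k l.+1.
Proof.
move=> ha kN lmN; rewrite !Q_sum -!sumrB !mulr_sumr -big_split /=.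
(* Termwise, the two sides differ by h n.+1 - h n, and h 0 = h k.+1 = 0. *)
pose h n : F := n%:R * (N%:R - n%:R + 1) * (a + n%:R - 1) * Q_coef N k n
                * poch (- l.+1%:R) n.-1.
apply/eqP; rewrite -subr_eq0 -sumrB; apply/eqP.
transitivity (\sum_(0 <= n < k.+1) (h n.+1 - h n)).
  rewrite big_mkord; apply: eq_bigr => -[n /= nk] _; rewrite ltnS in nk.
  have nkN : (n <= k <= N)%N by rewrite nk.
  have rec := Q_coef_rec ha nkN.
  have -> : h n.+1 = n.+1%:R * (N%:R - n%:R) * (a + n%:R) * Q_coef N k n.+1
                     * poch (- l.+1%:R) n.
    by rewrite /h -pred_Sn -natr1; ring.
  rewrite rec {rec}; case: n nk nkN => [|n] nk nkN.
    by rewrite /h !poch0 /theta; ring.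
  have D := pochN_difference n lmN.
  rewrite -!mulrBr ![_ * (Q_coef _ _ _ * _)]mulrCA -mulrDr D /h -pred_Sn /theta.
  by rewrite -[n.+1%:R]natr1; ring.
rewrite telescope_sumr // /h /Q_coef /jac_coef pochN_eq0 //; ring.
Qed.

Lemma Q_last N k : (forall j, (j < N)%N -> a + j%:R != 0) -> (k <= N)%N ->
  Q a b N k N = (-1) ^+ k * poch b k / poch a k.
Proof.
move=> ha kN; have pa n : (n <= k)%N -> poch a n != 0.
  by move=> nk; apply: poch_neq0 => j jn; apply: ha; lia.
(* The right-hand side is (1 - b - k)_k; reversing its factors gives (b)_k up to sign. At l = N,
   (-l)_n cancels (-N)_n, so the 3F2 becomes the 2F1 of Chu-Vandermonde. *)
have -> : (-1) ^+ k * poch b k = poch (a - (k%:R + a + b - 1)) k.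
  rewrite /poch -[k in (-1) ^+ k]card_ord -prodr_const -big_split /=.
  rewrite (reindex_inj rev_ord_inj) /=; apply: eq_bigr => i _.
  by rewrite natrB // -natr1; ring.
rewrite -chu_vandermonde Q_sum mulr_suml; apply: eq_bigr => -[n /= nk] _.
rewrite ltnS in nk; rewrite /Q_coef /jac_coef divfK; last by apply: pochN_neq0; lia.
have -> : poch a k = poch a n * poch (a + n%:R) (k - n).
  by rewrite -pochD subnKC.
have p0 : poch (a + n%:R) (k - n) != 0.
  by apply: poch_neq0 => j jn; rewrite -addrA -natrD; apply: ha; lia.
have f0 : n`!%:R != 0 :> F by rewrite pnatr_eq0 -lt0n fact_gt0.
rewrite pochN -bin_ffact natrM.
by field; rewrite ?f0 ?p0 ?pa.
Qed.

(** * Passage between the Bernstein and Jacobi bases *)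

Lemma monomial_bernstein N n : (n <= N)%N ->
  'X^n = \sum_(k < N.+1)
    ('C(N, k)%:R * poch (- k%:R) n / poch (- N%:R) n) *: ('X^k * (1 - 'X) ^+ (N - k))
  :> {poly F}.
Proof.
move=> nN; have pN : poch (- N%:R : F) n != 0 by apply: pochN_neq0.
have -> : 'X^n = 'X^n * ((1 - 'X) + 'X) ^+ (N - n) :> {poly F}.
  by rewrite subrK expr1n mulr1.
rewrite exprDn mulr_sumr.
rewrite -(big_mkord xpredT (fun k => ('C(N, k)%:R * poch (- k%:R) n / poch (- N%:R) n)
  *: ('X^k * (1 - 'X) ^+ (N - k)))).
rewrite (big_cat_nat (n := n)) //=; last by lia.
(* Terms with k < n vanish because (-k)_n = 0; the others are reindexed by k = n + i. *)
rewrite [X in _ = X + _]big_nat_cond [X in _ = X + _]big1 ?add0r; last first.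
  by move=> k; rewrite andbT => /andP[_ /pochN_eq0->]; rewrite mulr0 mul0r scale0r.
rewrite -[X in \sum_(X <= _ < _) _]add0n big_addn subSn // big_mkord.
apply: eq_bigr => -[i /= iN] _; rewrite -bin_pochN; last by lia.
rewrite mulfK // addnK addnC subnDA.
by rewrite scaler_nat exprD mulrnAr; congr (_ *+ _); ring.
Qed.

Lemma jac_bernstein N l : (l <= N)%N ->
  jac l = (poch a l / l`!%:R) *:
    \sum_(k < N.+1) ('C(N, k)%:R * Q a b N l k) *: ('X^k * (1 - 'X) ^+ (N - k)).
Proof.
move=> lN; congr (_ *: _).
transitivity (\sum_(n < l.+1) jac_coef l n *: 'X^n).
  by rewrite /hyper poly_def; apply: eq_bigr => n _; rewrite !big_cons !big_nil !mulr1.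
rewrite (eq_bigr (fun n : 'I_l.+1 => \sum_(k < N.+1)
  (jac_coef l n * ('C(N, k)%:R * poch (- k%:R) n / poch (- N%:R) n))
    *: ('X^k * (1 - 'X) ^+ (N - k)))); last first.
  move=> n _; rewrite {1}(@monomial_bernstein N n); last by have := ltn_ord n; lia.
  by rewrite scaler_sumr; apply: eq_bigr => k _; rewrite scalerA.
rewrite exchange_big; apply: eq_bigr => k _ /=; rewrite -scaler_suml; congr (_ *: _).
by rewrite Q_sum mulr_sumr; apply: eq_bigr => n _; rewrite /Q_coef; ring.
Qed.

(** The part of the coefficient in the second identity that does not depend on l. *)
Definition inv_coef N k : F :=
  'C(N, k)%:R * (k`!%:R
    / (poch b k * poch (a + b + k%:R - 1) k * poch (a + b + (2 * k)%:R) (N - k))).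

Lemma bernstein_jac N l m :
  (forall j, (j < N)%N -> a + j%:R != 0) ->
  (forall j, (j < N)%N -> b + j%:R != 0) ->
  (forall j, (j.+1 < 2 * N)%N -> a + b + j%:R != 0) ->
  (l + m = N)%N ->
  'X^l * (1 - 'X) ^+ m = (poch a l * poch b m) *:
    \sum_(k < N.+1) (inv_coef N k * Q a b N k l) *: jac k.
Proof.
(* The descent in l is a strong induction on m = N - l, since index l is recovered from l + 1 and l
   + 2. *)
move=> ha hb hab; elim/ltn_ind: m l => -[|m] IHm l lmN.
  have lN : l = N by lia.
  rewrite lN expr0 mulr1 poch0 mulr1 monomial_jac // scaler_sumr.
  apply: eq_bigr => k _; have kN : (k <= N)%N by rewrite -ltnS.
  rewrite [RHS]scalerA; congr (_ *: _); rewrite Q_last // /mono_coef /inv_coef.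
  have pa : poch a k != 0 by apply: poch_neq0 => j jk; apply: ha; lia.
  have pb : poch b k != 0 by apply: poch_neq0 => j jk; apply: hb; lia.
  have p1 := poch_shift_neq0 hab kN; have p2 := poch_double_shift_neq0 k hab.
  by field; rewrite ?pa ?pb ?p1 ?p2.
pose S l := \sum_(k < N.+1) (inv_coef N k * Q a b N k l) *: jac k.
have al : a + l%:R != 0 by apply: ha; lia.
have l1 : l.+1%:R != 0 :> F by rewrite pnatr_eq0.
have op := jac_op_bernstein a b l m.
have IH1 : 'X^(l.+1) * (1 - 'X) ^+ m = (poch a l.+1 * poch b m) *: S l.+1.
  by apply: IHm => //; lia.
have IH2 : (m%:R * (m%:R - 1 + b)) *: ('X^(l.+2) * (1 - 'X) ^+ m.-1)
  = (m%:R * (m%:R - 1 + b) * (poch a l.+2 * poch b m.-1)) *: S l.+2.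
  (* For m = 0 the index l + 2 exceeds N and no hypothesis applies, but the coefficient is 0. *)
  case: (posnP m) => [->|m0]; first by rewrite !mul0r !scale0r.
  by rewrite [LHS](congr1 _ (IHm m.-1 _ l.+2 _)) ?scalerA //; lia.
have opS : jac_op (S l.+1) = (l.+1%:R * (b + m%:R)) *: (S l - S l.+1)
    + (m%:R * (a + l.+1%:R)) *: (S l.+2 - S l.+1).
  rewrite /S linear_sum -!sumrB !scaler_sumr -big_split /=.
  apply: eq_bigr => k _; have kN : (k <= N)%N by rewrite -ltnS.
  rewrite linearZ /= jac_op_jac => [|j jk]; last by apply: ha; lia.
  move: (jac k) => J; rewrite scalerA -!scalerBl !scalerA -scalerDl; congr (_ *: _).
  have lmN' : (l.+1 + m = N)%N by lia.
  transitivity (inv_coef N k * (- theta k * Q a b N k l.+1)); first by ring.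
  by rewrite -(Q_difference ha kN lmN'); ring.
have C2 : m%:R * (m%:R - 1 + b) * (poch a l.+2 * poch b m.-1)
  = poch a l.+1 * poch b m * (m%:R * (a + l.+1%:R)).
  case: (m) => [|p]; first by ring.
  by rewrite -pred_Sn (pochS a l.+1) (pochS b p) -natr1; ring.
have C0 : poch a l.+1 * poch b m * (l.+1%:R * (b + m%:R))
    = (l.+1%:R * (l%:R + a)) * (poch a l * poch b m.+1).
  by rewrite !pochS; ring.
(* This is the coefficient of the unknown term of index l in the three-term relation, so that
   relation can be solved for it. *)
have lc : l.+1%:R * (l%:R + a) != 0 by rewrite mulf_neq0 // addrC.
apply: (scalerI lc); rewrite -/(S l) scalerA -C0.
move: op; rewrite IH2 IH1 C2 linearZ /= opS.
move: (poch a l.+1 * poch b m) => c.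
rewrite -!scalerA -!mul_polyC => op.
move/eqP: op; rewrite -subr_eq0 => /eqP op.
apply/eqP; rewrite -subr_eq0 -[0]oppr0 -op; apply/eqP; ring.
Qed.

End Expansions.

(** * Return from t = x / (x + y) to the variables x and y *)

Section Ratios.
Variable K : fieldType.
Implicit Types x y : K.

Lemma one_sub_ratio x y : x + y != 0 ->
  1 - (y - x) / (x + y) = 2%:R * (x / (x + y)).
Proof. by move=> xy0; field. Qed.

Lemma ratio_compl x y : x + y != 0 -> 1 - x / (x + y) = y / (x + y).
Proof. by move=> xy0; field. Qed.

Lemma ratio_powers x y m n : x + y != 0 ->
  x ^+ m * y ^+ n
  = (x + y) ^+ (m + n) * ((x / (x + y)) ^+ m * (y / (x + y)) ^+ n).
Proof.
by move=> xy0; rewrite exprD mulrACA -!exprMn ![(x + y) * _]mulrC !divfK.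
Qed.

End Ratios.

Section Homogenization.
Variable F : numFieldType.
Implicit Types (a b c : F) (p : {poly F}) (k l N : nat).

HB.instance Definition _ :=
  GRing.RMorphism.copy (@cst F) (@tofrac {mpoly F[2]} \o @mpolyC 2 F).

Local Notation x := (varx F).
Local Notation y := (vary F).

Lemma xy_neq0 : x + y != 0.
Proof.
rewrite /varx /vary -rmorphD /= tofrac_eq0.
(* Evaluation at (1, 1) gives 2, which is nonzero in characteristic 0. *)
apply/eqP => /(congr1 (meval (fun=> 1))) /eqP.
by rewrite mevalD !mevalXU meval0 -[1 + 1]/(2%:R) pnatr_eq0.
Qed.

(** Undoes the division by (x + y)^N; being linear over constants, it carries expansions in t to
    expansions in F(x, y). *)
Definition homogenize N p : ratfun F := (x + y) ^+ N * (map_poly (@cst F) p).[x / (x + y)].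

Lemma homogenizeZ N c p : homogenize N (c *: p) = cst c * homogenize N p.
Proof. by rewrite /homogenize map_polyZ hornerZ mulrCA. Qed.

Lemma homogenize_sum N (I : Type) (r : seq I) (f : I -> {poly F}) :
  homogenize N (\sum_(i <- r) f i) = \sum_(i <- r) homogenize N (f i).
Proof. by rewrite /homogenize rmorph_sum horner_sum mulr_sumr. Qed.

Lemma w_homogenize a b N l : w a b N l = homogenize N (jac a b l).
Proof.
rewrite /w /homogenize /jacobi /jac; congr (_ * _).
rewrite !map_polyZ !hornerZ map_comp_poly horner_comp; congr (_ * _.[_]).
rewrite map_polyZ hornerZ rmorphB rmorph1 /= map_polyX !hornerE.
have half : cst (2%:R^-1) * 2%:R = 1 :> ratfun F.
  rewrite -(rmorph_nat (@cst F)) -[LHS](rmorphM (@cst F)).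
  by rewrite mulVf ?pnatr_eq0 // rmorph1.
rewrite one_sub_ratio ?xy_neq0 //.
by set t := _ / _; rewrite mulrA half mul1r.
Qed.

Lemma v_homogenize N k : (k <= N)%N -> v F N k = homogenize N ('X^k * (1 - 'X) ^+ (N - k)).
Proof.
move=> kN; rewrite /v /homogenize rmorphM !rmorphXn rmorphB rmorph1 /= map_polyX.
rewrite !hornerE ratio_compl ?xy_neq0 // (ratio_powers k (N - k) xy_neq0) subnKC //.
exact: mulrA.
Qed.

End Homogenization.

Theorem theorem3p7 (R : realType) (N : nat) (lam1 lam2 : R[i])
  (hN : (1 <= N)%N)
  (h1 : forall j : nat, (j <= N - 1)%N -> lam1 <> - j%:R)
  (h2 : forall j : nat, (j <= N - 1)%N -> lam2 <> - j%:R)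
  (h12 : forall j : nat, (j <= 2 * N - 2)%N -> lam1 + lam2 <> - j%:R)
  (l : nat) (hl : (l <= N)%N) :
  w lam1 lam2 N l =
    cst (poch lam1 l / l`!%:R) *
      (\sum_(k < N.+1) cst ('C(N, k)%:R * Q lam1 lam2 N l k) * v _ N k)
  /\
  v _ N l =
    \sum_(k < N.+1)
      cst ('C(N, k)%:R
           * (k`!%:R * poch lam1 l * poch lam2 (N - l)
              / (poch lam2 k * poch (lam1 + lam2 + k%:R - 1) k
                 * poch (lam1 + lam2 + (2 * k)%:R) (N - k)))
           * Q lam1 lam2 N k l)
      * w lam1 lam2 N k.
Proof.
(* The excluded values are restated as nonvanishing; as N >= 1, the bounds j <= N - 1 and j <= 2N -
   2 become j < N and j + 1 < 2N. *)
have ha j : (j < N)%N -> lam1 + j%:R != 0.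
  by move=> jN; rewrite addr_eq0; apply/eqP/h1; lia.
have hb j : (j < N)%N -> lam2 + j%:R != 0.
  by move=> jN; rewrite addr_eq0; apply/eqP/h2; lia.
have hab j : (j.+1 < 2 * N)%N -> lam1 + lam2 + j%:R != 0.
  by move=> jN; rewrite addr_eq0; apply/eqP/h12; lia.
split.
  rewrite w_homogenize (jac_bernstein _ _ hl) homogenizeZ homogenize_sum; congr (_ * _).
  apply: eq_bigr => k _; rewrite homogenizeZ v_homogenize //; exact: leq_ord.
rewrite v_homogenize // (bernstein_jac ha hb hab (subnKC hl)) homogenizeZ.
rewrite homogenize_sum mulr_sumr.
apply: eq_bigr => k _; rewrite homogenizeZ w_homogenize mulrA.
rewrite -[X in X * _ = _](rmorphM (@cst _)); congr (cst _ * _).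
by rewrite /inv_coef; ring.
Qed.
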